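(* Let $n\ge 1$ and $1\le r\le n$ be integers. Every deterministic online algorithm for $r$-uniform Online Min-Sum Set Cover on a universe of $n$ elements has competitive ratio (against the static optimum) at least $(r+1)\left(1-\frac{r}{n+1}\right)$.
   Context: Let $U$ be a set of $n$ elements. A permutation $\pi$ of $U$ assigns each element $e$ a position $\pi[e]\in\{1,\dots,n\}$. For nonempty $S\subseteq U$, the access (cover) cost is $\pi(S)=\min_{e\in S}\pi[e]$. The Kendall tau distance $d_{KT}(\pi,\sigma)$ is the number of unordered pairs $\{a,b\}\subseteq U$ ordered differently by $\pi$ and $\sigma$. In $r$-uniform Online Min-Sum Set Cover, an initial permutation $\pi_0$ is given and request sets $S_1,\dots,S_m\subseteq U$ with $|S_t|=r$ arrive one by one. When $S_t$ arrives, the algorithm, holding permutation $\pi_{t-1}$, pays access cost $\pi_{t-1}(S_t)$ and then chooses a new permutation $\pi_t$ (depending only on $S_1,\dots,S_t$ and $\pi_0$), paying moving cost $d_{KT}(\pi_{t-1},\pi_t)$. The algorithm's cost is the total access plus moving cost. The static optimum is $\mathrm{OPT}=\min_{\pi}\sum_{t=1}^m\pi(S_t)$ over all permutations $\pi$ of $U$. An online algorithm is $c$-competitive if there is a constant $\alpha$ (independent of the request sequence, possibly depending on $n,r$) such that its cost is at most $c\cdot\mathrm{OPT}+\alpha$ for every initial permutation and request sequence; its competitive ratio is the infimum of such $c$. *)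

(* Defs.v *)
From HB Require Import structures.
From mathcomp Require Import all_boot all_order all_algebra.
From mathcomp Require Import all_classical all_reals ereal.

Set Implicit Arguments.
Unset Strict Implicit.
Unset Printing Implicit Defensive.

Import Order.TTheory GRing.Theory Num.Theory.

Local Open Scope ring_scope.
Local Open Scope classical_set_scope.

Definition ranking (U : finType) :=
  {f : {ffun U -> 'I_#|U|} | injectiveb f}.

(* Positions are numbered from 1, whereas ordinals start at 0. *)
Definition pos (U : finType) (p : ranking U) (e : U) : nat := (val p e).+1.

(* Every position is at most #|U|, so the default value #|U| of the iterated
   minimum does not affect the result when S is nonempty. *)
Definition access (U : finType) (p : ranking U) (S : {set U}) : nat :=
  \big[minn/#|U|]_(e in S) pos p e.

Definition kendall_tau (U : finType) (p q : ranking U) : nat :=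
  #|[set D : {set U} | [exists a, exists b,
      [&& D == [set a; b]%SET, (pos p a < pos p b)%N & (pos q b < pos q a)%N]]]%SET|.

(* The permutation chosen by the algorithm, given the initial permutation and
   all the requests received so far, in order of arrival. *)
Definition online_alg (U : finType) := ranking U -> seq {set U} -> ranking U.

(* Before any request the algorithm holds p0: A p0 [::] is irrelevant. *)
Definition current (U : finType) (A : online_alg U) (p0 : ranking U)
    (past : seq {set U}) : ranking U :=
  if past is [::] then p0 else A p0 past.

Definition alg_cost (U : finType) (A : online_alg U) (p0 : ranking U)
    (s : seq {set U}) : nat :=
  (\sum_(t < size s)
     (access (current A p0 (take t s)) (nth finset.set0 s t) +
      kendall_tau (current A p0 (take t s)) (current A p0 (take t.+1 s))))%N.

Definition static_cost (U : finType) (p : ranking U) (s : seq {set U}) : nat :=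
  (\sum_(S <- s) access p S)%N.

Lemma enum_ranking_subproof (U : finType) :
  injectiveb [ffun e : U => enum_rank e].
Proof. by apply/injectiveP => x y; rewrite !ffunE => /enum_rank_inj. Qed.

Definition enum_ranking (U : finType) : ranking U :=
  Sub [ffun e : U => enum_rank e] (enum_ranking_subproof U).

(* The default value of the iterated minimum is itself the cost of one of the
   permutations, so this is the minimum over all permutations. *)
Definition opt (U : finType) (s : seq {set U}) : nat :=
  \big[minn/static_cost (enum_ranking U) s]_(p : ranking U) static_cost p s.

Definition uniform (U : finType) (r : nat) (s : seq {set U}) : bool :=
  all (fun S : {set U} => #|S| == r) s.

Definition competitive (R : realType) (U : finType) (r : nat)
    (A : online_alg U) (c : R) : Prop :=
  exists alpha : R, forall (p0 : ranking U) (s : seq {set U}), uniform r s ->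
    (alg_cost A p0 s)%:R <= c * (opt s)%:R + alpha.

(* The infimum is taken in the extended reals, so an algorithm that is
   c-competitive for no c has ratio +oo. *)
Definition competitive_ratio (R : realType) (U : finType) (r : nat)
    (A : online_alg U) : \bar R :=
  ereal_inf [set c%:E | c in [set c : R | competitive r A c]].

(* Main.v *)
Require Import Defs.
From mathcomp Require Import all_boot all_order all_algebra.
From mathcomp Require Import all_classical all_reals ereal.
From mathcomp Require Import all_fingroup.
From mathcomp Require Import zify ring lra.
Import Order.TTheory GRing.Theory Num.Theory.
Local Open Scope ring_scope.

(** The adversary always requests the last r elements of the algorithm's
    current permutation, so that every access costs at least n - r + 1. Averaged
    over all permutations, the cost of accessing a fixed r-set is
    C(n+1,r+1) / C(n,r) = (n+1) / (r+1): by symmetry it does not depend on the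
    set, and for a fixed permutation the costs of all r-sets add up to
    C(n+1,r+1). Hence some static permutation pays at most (n+1) / (r+1) per
    request. *)

Section Average.
Set Implicit Arguments.
Unset Strict Implicit.
Variable U : finType.
Implicit Types (p q : ranking U) (S T : {set U}) (g : {perm U}).

(** * Access costs as counts of tails of a permutation *)

Lemma bigminn_le (I : finType) (P : pred I) (F : I -> nat) d i :
  P i -> (\big[minn/d]_(j | P j) F j <= F i)%N.
Proof.
move=> Pi; have: i \in index_enum I by exact: mem_index_enum.
elim: (index_enum I) => //= j s IHs.
rewrite inE big_cons => /predU1P[<-|/IHs le_i]; first by rewrite Pi geq_minl.
by case: ifP => // _; rewrite geq_min le_i orbT.
Qed.

Lemma val_ranking_inj p : injective (val p).
Proof. by apply/injectiveP; exact: (valP p). Qed.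

(** Positions start at 1, so [k < pos p e] amounts to [k <= val p e]; the bound on [k] accounts for
    the default value [#|U|] of the minimum. *)
Lemma ltn_access p S k :
  (k < access p S)%N = (k < #|U|)%N && [forall (e | e \in S), (k <= val p e)%N].
Proof.
apply/idP/andP => [lt_k | [lt_k /forall_inP le_k]]; last first.
  by rewrite /access; elim/big_ind: _ => // x y Hx Hy; rewrite leq_min Hx.
split; last first.
  apply/forall_inP => e eS; rewrite -ltnS.
  by apply: (leq_trans lt_k); exact: bigminn_le.
apply: (leq_trans lt_k); rewrite /access.
by elim/big_rec: _ => // e x _ Hx; rewrite geq_min Hx orbT.
Qed.

Lemma access_le p S : (access p S <= #|U|)%N.
Proof. by rewrite leqNgt ltn_access ltnn. Qed.

Definition tail_set p k : {set U} := [set e | (k <= val p e)%N].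

(** A number is the count of the [k] below it. This turns the minimum into a sum, which can be
    exchanged with sums over sets or rankings. *)
Lemma access_sum p S : (access p S = \sum_(k < #|U|) (S \subset tail_set p k))%N.
Proof.
transitivity (\sum_(k < #|U| | (k < access p S)%N) 1)%N.
  by rewrite (big_ord_narrow (access_le p S)) sum1_card card_ord.
rewrite big_mkcond /=; apply: eq_bigr => k _; rewrite ltn_access ltn_ord /=.
suff -> : [forall (e | e \in S), (k <= val p e)%N] = (S \subset tail_set p k)
  by case: (_ \subset _).
by apply/forall_inP/fintype.subsetP => H e /H; rewrite inE.
Qed.

Lemma card_tail_set p k : #|tail_set p k| = (#|U| - k)%N.
Proof.
rewrite -(card_imset _ (@val_ranking_inj p)).
have -> : [set val p x | x in tail_set p k]%SET = [set i : 'I_#|U| | (k <= i)%N]%SET.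
  have [h _ hK] : bijective (val p).
    by apply: inj_card_bij; [exact: val_ranking_inj | rewrite card_ord].
  apply/setP => i; rewrite inE; apply/imsetP/idP => [[e] | le_ki].
    by rewrite inE => ? ->.
  by exists (h i); rewrite ?inE hK.
rewrite -sum1_card; under eq_bigl do rewrite inE.
rewrite big_mkcond /=; elim: #|U| => [|n IHn]; first by rewrite big_ord0.
by rewrite big_ord_recr IHn /=; case: leqP; lia.
Qed.

Lemma access_tail_set p r : (1 <= r <= #|U|)%N ->
  (#|U| - r < access p (tail_set p (#|U| - r)))%N.
Proof.
case/andP=> r_gt0 le_rU; rewrite ltn_access.
rewrite ltn_subrL r_gt0 (leq_trans r_gt0 le_rU) /=.
by apply/forall_inP => e; rewrite inE.
Qed.

(** * Double counting of access costs over sets and rankings *)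

Lemma hockey_stick n r : (0 < r)%N ->
  (\sum_(k < n) 'C(n - k, r) = 'C(n.+1, r.+1))%N.
Proof.
move=> r_gt0; elim: n => [|n IHn]; first by rewrite big_ord0 bin_small.
rewrite big_ord_recl /= subn0 binS addnC -IHn.
by congr (_ + _)%N; apply: eq_bigr => k _.
Qed.

Lemma sum_access_sets p r : (0 < r)%N ->
  (\sum_(S : {set U} | #|S| == r) access p S = 'C(#|U|.+1, r.+1))%N.
Proof.
move=> r_gt0; rewrite -hockey_stick //.
under eq_bigr do rewrite access_sum.
rewrite exchange_big /=; apply: eq_bigr => k _.
(* For each [k], what remains is to count the [r]-subsets of a tail with [#|U| - k] elements. *)
rewrite -[X in 'C(X, r)](card_tail_set p) -cards_draws -[RHS]sum1_card big_mkcond /=.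
rewrite [RHS]big_mkcond /=; apply: eq_bigr => S _; rewrite inE.
by case: (S \subset _); case: (#|S| == r).
Qed.

Lemma perm_imset S T : #|S| = #|T| -> exists g, [set g x | x in S]%SET = T.
Proof.
move=> eqST.
(* Take g maximizing the overlap of its image of S with T: if some y in the
   image were outside T, composing g with the transposition of y and a missed
   z in T would increase the overlap. *)
have [g _ gmax] :=
  @arg_maxnP _ 1%g xpredT (fun g : {perm U} => #|T :&: [set g x | x in S]|%SET) isT.
exists g; apply/eqP; set V := [set g x | x in S]%SET.
have cardV : #|V| = #|T| by rewrite card_imset //; exact: perm_inj.
rewrite eqEcard cardV leqnn andbT; apply: contraT => /subsetPn[y yV yNT].
have /subsetPn[z zT zNV] : ~~ (T \subset V).
  apply: contra yNT => TV.
  by have /eqP -> : T == V by rewrite eqEcard TV cardV /=.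
have := gmax (g * tperm y z)%g isT; rewrite /= leqNgt => /negP[].
rewrite -/V; apply: proper_card.
have -> : [set (g * tperm y z)%g x | x in S]%SET = [set tperm y z x | x in V]%SET.
  by rewrite -imset_comp; apply: eq_imset => x; rewrite permM.
apply/properP; split.
  apply/fintype.subsetP => x /setIP[xT xV]; rewrite inE xT /=.
  apply/imsetP; exists x => //; rewrite tpermD //.
    by apply: contraNneq yNT => ->.
  by apply: contraNneq zNV => ->.
exists z; last by rewrite inE (negbTE zNV) andbF.
by rewrite inE zT /=; apply/imsetP; exists y; rewrite ?tpermL.
Qed.

Lemma relabel_subproof p g : injectiveb [ffun e => val p (g e)].
Proof.
by apply/injectiveP => x y; rewrite !ffunE => /val_ranking_inj/perm_inj.
Qed.

(** Permutations of [U] act on rankings by precomposition; being bijective, this action can reindex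
    a sum over all rankings. *)
Definition relabel g p : ranking U :=
  Sub [ffun e => val p (g e)] (relabel_subproof p g).

Lemma relabel_inj g : injective (relabel g).
Proof.
move=> p q /(congr1 val) /ffunP eqpq; apply/val_inj/ffunP => e.
by have := eqpq (g^-1 e)%g; rewrite !ffunE permKV.
Qed.

Lemma access_relabel p g S : access (relabel g p) S = access p [set g x | x in S]%SET.
Proof.
rewrite !access_sum; apply: eq_bigr => k _; rewrite sub_imset_pre.
by congr nat_of_bool; apply: eq_subset_r => e; rewrite !inE ffunE.
Qed.

Lemma sum_access_rankings r S : (0 < r)%N -> #|S| = r ->
  ((\sum_(p : ranking U) access p S) * r.+1 = #|{: ranking U}| * #|U|.+1)%N.
Proof.
move=> r_gt0 cardS.
have sumE T : #|T| == r ->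
    (\sum_(p : ranking U) access p T = \sum_(p : ranking U) access p S)%N.
  move=> /eqP cardT; have [g <-] := @perm_imset S T (etrans cardS (esym cardT)).
  rewrite [RHS](reindex_inj (@relabel_inj g)).
  by apply: eq_bigr => p _; rewrite access_relabel.
have count : ('C(#|U|, r) * \sum_(p : ranking U) access p S
               = #|{: ranking U}| * 'C(#|U|.+1, r.+1))%N.
  transitivity (\sum_(T : {set U} | #|T| == r) \sum_(p : ranking U) access p T)%N.
    rewrite (eq_bigr _ sumE) sum_nat_const; congr (_ * _)%N.
    by rewrite -card_draws; apply: eq_card => T; rewrite inE.
  rewrite exchange_big /= (eq_bigr _ (fun p _ => @sum_access_sets p r r_gt0)).
  by rewrite sum_nat_const.
have C_gt0 : (0 < 'C(#|U|, r))%N by rewrite bin_gt0 -cardS max_card.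
apply/eqP; rewrite -(eqn_pmul2l C_gt0) mulnA count -mulnA.
rewrite [X in _ == X]mulnCA eqn_pmul2l; last first.
  by apply/card_gt0P; exists (enum_ranking U).
(* Absorption: [(r+1) C(n+1,r+1) = (n+1) C(n,r)], with [n = #|U|]. *)
by rewrite mulnC -mul_bin_diag mulnC.
Qed.

Lemma opt_le_static p s : (opt s <= static_cost p s)%N.
Proof. exact: bigminn_le. Qed.

Lemma opt_uniform_le r (s : seq {set U}) : (0 < r)%N -> uniform r s ->
  (opt s * r.+1 <= size s * #|U|.+1)%N.
Proof.
move=> r_gt0 /allP us.
(* Minimum is at most average, with the number of rankings multiplied out to stay in [nat]. *)
have /leq_pmul2l <- : (0 < #|{: ranking U}|)%N.
  by apply/card_gt0P; exists (enum_ranking U).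
apply: (@leq_trans ((\sum_(p : ranking U) static_cost p s) * r.+1)%N).
  by rewrite mulnA leq_mul2r -sum_nat_const leq_sum ?orbT // => p _;
     exact: opt_le_static.
rewrite /static_cost exchange_big /= big_distrl /=.
rewrite big_seq (eq_bigr (fun=> #|{: ranking U}| * #|U|.+1)%N); last first.
  by move=> S /us /eqP; exact: sum_access_rankings.
by rewrite -big_seq big_const_seq count_predT iter_addn_0 -mulnA [X in (_ * X)%N]mulnC.
Qed.

End Average.

(** * The adaptive request sequence *)

Section Adversary.
Set Implicit Arguments.
Unset Strict Implicit.
Variables (U : finType) (r : nat) (A : online_alg U) (p0 : ranking U).

Fixpoint adversary m : seq {set U} :=
  if m is m'.+1 then
    rcons (adversary m') (tail_set (current A p0 (adversary m')) (#|U| - r))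
  else [::].

Lemma size_adversary m : size (adversary m) = m.
Proof. by elim: m => //= m IHm; rewrite size_rcons IHm. Qed.

Lemma uniform_adversary m : (r <= #|U|)%N -> uniform r (adversary m).
Proof.
move=> le_rU; elim: m => //= m IHm.
by rewrite /uniform all_rcons card_tail_set subKn // eqxx.
Qed.

(** Requests are only ever appended, so the history at time [t] is the same for every length
    [m >= t]. *)
Lemma take_adversary m t : (t <= m)%N -> take t (adversary m) = adversary t.
Proof.
elim: m => [|m IHm]; first by rewrite leqn0 => /eqP->.
rewrite leq_eqVlt => /predU1P[->|]; first by rewrite take_oversize // size_adversary.
by rewrite ltnS => le_tm; rewrite /= -cats1 takel_cat ?size_adversary // IHm.
Qed.

Lemma nth_adversary m t : (t < m)%N ->
  nth finset.set0 (adversary m) t = tail_set (current A p0 (adversary t)) (#|U| - r).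
Proof.
move=> lt_tm; rewrite -(nth_take _ (ltnSn t)) take_adversary //=.
by rewrite nth_rcons size_adversary ltnn eqxx.
Qed.

Lemma alg_cost_adversary m : (1 <= r <= #|U|)%N ->
  (m * (#|U| - r).+1 <= alg_cost A p0 (adversary m))%N.
Proof.
move=> hr; rewrite /alg_cost size_adversary -[X in (X * _)%N]card_ord -sum_nat_const.
apply: leq_sum => t _; rewrite take_adversary ?nth_adversary ?(ltnW (ltn_ord t)) //.
(* Moving costs are bounded below by 0. *)
exact: leq_trans (access_tail_set _ hr) (leq_addr _ _).
Qed.

End Adversary.

(** * From costs per request to the competitive ratio *)

Section Ratio.
Set Implicit Arguments.
Unset Strict Implicit.

(** By the Archimedean property, a positive gap [x - y] times a large [m] would exceed [a]; this
    removes the additive constant. *)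
Lemma le_of_natr_affine (R : realType) (x y a : R) :
  (forall m : nat, m%:R * x <= m%:R * y + a) -> x <= y.
Proof.
move=> H; rewrite leNgt; apply/negP => lt_yx.
have d_gt0 : 0 < x - y by rewrite subr_gt0.
have := archi_boundP (normr_ge0 (a / (x - y))).
set m := Num.bound _ => lt_m.
have : a / (x - y) < m%:R by apply: le_lt_trans (ler_norm _) lt_m.
by rewrite ltr_pdivrMr // mulrBr; have := H m; lra.
Qed.

Lemma competitive_ge (R : realType) (U : finType) (r : nat) (A : online_alg U)
    (c : R) : (1 <= r <= #|U|)%N -> competitive r A c ->
  (r%:R + 1) * (1 - r%:R / (#|U|%:R + 1)) <= c.
Proof.
move=> hr [alpha comp]; have /andP[r_gt0 le_rU] := hr.
set n := #|U| in hr le_rU *.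
(* c might be negative, so opt s can only be bounded after passing to c0. *)
set c0 := Num.max c 0.
have c0_ge0 : 0 <= c0 by rewrite le_max lexx orbT.
have n1_gt0 : 0 < n%:R + 1 :> R by rewrite natr1 ltr0n.
have r1_gt0 : 0 < r%:R + 1 :> R by rewrite natr1 ltr0n.
have gap : (n - r).+1%:R <= c0 * ((n%:R + 1) / (r%:R + 1)).
  apply: (@le_of_natr_affine _ _ _ alpha) => m.
  set s := adversary r A (enum_ranking U) m.
  have us : uniform r s by exact: uniform_adversary.
  have := comp (enum_ranking U) s us.
  have : m%:R * (n - r).+1%:R <= (alg_cost A (enum_ranking U) s)%:R :> R.
    by rewrite -natrM ler_nat alg_cost_adversary.
  have : c * (opt s)%:R <= c0 * (opt s)%:R by rewrite ler_wpM2r // le_max lexx.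
  suff : c0 * (opt s)%:R <= m%:R * (c0 * ((n%:R + 1) / (r%:R + 1))) by lra.
  rewrite mulrCA ler_wpM2l // mulrA ler_pdivlMr // !natr1 -!natrM ler_nat.
  by rewrite -[X in (_ <= X * _)%N](size_adversary r A (enum_ranking U) m) opt_uniform_le.
have ltE : (n - r).+1%:R = n%:R + 1 - r%:R :> R.
  by rewrite -natr1 natrB //; lra.
(* The bound is the quotient of the two costs per request, [n - r + 1] and [(n+1)/(r+1)]. *)
have targetE : (r%:R + 1) * (1 - r%:R / (n%:R + 1))
    = (n - r).+1%:R / ((n%:R + 1) / (r%:R + 1)) :> R.
  by rewrite ltE; field; rewrite !gt_eqF.
have : (n - r).+1%:R / ((n%:R + 1) / (r%:R + 1)) <= c0.
  by rewrite ler_pdivrMr // divr_gt0.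
(* The bound is at most [c] or at most 0; the latter fails because it is positive. *)
rewrite -targetE /c0 le_max => /orP[//|].
by rewrite targetE leNgt !divr_gt0 // ltr0n.
Qed.

End Ratio.

Theorem theorem1 (R : realType) (U : finType) (n r : nat)
  (hU : #|U| = n) (hn : (1 <= n)%N) (hr : (1 <= r <= n)%N)
  (A : online_alg U) :
  (((r%:R + 1) * (1 - r%:R / (n%:R + 1)))%:E <= competitive_ratio R r A)%E.
Proof.
subst n; apply/ereal_infP => _ [c comp <-].
by rewrite lee_fin; exact: (@competitive_ge R U r A c hr comp).
Qed.
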